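(* Let $(Q,\cdot)$ be a maximally nonassociative finite quasigroup and let $(U,* )$ be an idempotent quasigroup with $|Q|\ge |U|$. Let $j\colon U\to Q$ be an injective mapping, and let $+$ be any abelian group operation on the set $Q$. Then $$(x,u)(y,v)=\begin{cases}(x\cdot y,\,u) & \text{if } u=v,\\ (x+y+j(u),\,u*v) & \text{if } u\ne v\end{cases}$$ defines a maximally nonassociative quasigroup operation on $Q\times U$.
   Context: A quasigroup is a set $Q$ with a binary operation $\cdot$ such that for all $a,b\in Q$ the equations $x\cdot a=b$ and $a\cdot y=b$ have unique solutions $x,y\in Q$. It is idempotent if $x\cdot x=x$ for all $x\in Q$. A quasigroup $Q$ is maximally nonassociative if for all $x,y,z\in Q$, $x\cdot(y\cdot z)=(x\cdot y)\cdot z$ implies $x=y=z$. *)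

(* Defs.v *)
From mathcomp Require Import all_boot.

Set Implicit Arguments.
Unset Strict Implicit.
Unset Printing Implicit Defensive.

Definition quasigroup (Q : Type) (op : Q -> Q -> Q) : Prop :=
  forall a b : Q, (exists! x, op x a = b) /\ (exists! y, op a y = b).

Definition maximally_nonassociative (Q : Type) (op : Q -> Q -> Q) : Prop :=
  quasigroup op /\
  forall x y z : Q, op x (op y z) = op (op x y) z -> x = y /\ y = z.

Definition abelian_group_op (Q : Type) (add : Q -> Q -> Q) : Prop :=
  [/\ associative add, commutative add
    & exists (zero : Q) (opp : Q -> Q),
        left_id zero add /\ left_inverse zero opp add].

Definition product_op (Q : Type) (U : eqType) (dot add : Q -> Q -> Q)
    (star : U -> U -> U) (j : U -> Q) (p q : Q * U) : Q * U :=
  let: (x, u) := p in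
  let: (y, v) := q in
  if u == v then (dot x y, u) else (add (add x y) (j u), star u v).

(* Main.v *)
Require Import Defs.
From mathcomp Require Import all_boot.

(** In the product the second coordinates always multiply by [star], because
    [star] is idempotent.  Let [(x,u)], [(y,v)], [(z,w)] associate.  If [u], [v],
    [w] are not all equal, then, outside the degenerate cases [u = v], [v = w],
    [u = v * w], [u * v = w], which cancellation in [star] rules out, comparing
    first coordinates leaves [j v = j (u * v)], so [v * v = v = u * v] and
    [u = v], a contradiction. *)

Lemma quasigroup_mulIr (Q : Type) (op : Q -> Q -> Q) (a x y : Q) :
  quasigroup op -> op x a = op y a -> x = y.
Proof.
move=> qop eq_xy; have [[t [_ t_uniq]] _] := qop a (op y a).
by rewrite -(t_uniq _ eq_xy) -(t_uniq y erefl).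
Qed.

Lemma quasigroup_mulIl (Q : Type) (op : Q -> Q -> Q) (a x y : Q) :
  quasigroup op -> op a x = op a y -> x = y.
Proof.
move=> qop eq_xy; have [_ [t [_ t_uniq]]] := qop a (op a y).
by rewrite -(t_uniq _ eq_xy) -(t_uniq y erefl).
Qed.

Lemma quasigroupP (Q : Type) (op : Q -> Q -> Q) :
  (forall a x y, op x a = op y a -> x = y) ->
  (forall a x y, op a x = op a y -> x = y) ->
  (forall a b, exists x, op x a = b) ->
  (forall a b, exists y, op a y = b) ->
  quasigroup op.
Proof.
move=> injr injl surjr surjl a b; split.
- by have [x <-] := surjr a b; exists x; split=> // t /esym/injr.
- by have [y <-] := surjl a b; exists y; split=> // t /esym/injl.
Qed.

Lemma abelian_group_quasigroup (Q : Type) (add : Q -> Q -> Q) :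
  abelian_group_op add -> quasigroup add.
Proof.
case=> addA addC [zero [opp [add0 addN]]].
have injl a x y : add a x = add a y -> x = y.
  by move/(congr1 (add (opp a))); rewrite !addA addN !add0.
have surjl a b : exists y, add a y = b.
  by exists (add (opp a) b); rewrite addA (addC a) addN add0.
apply: quasigroupP => // [a x y|a b].
- by rewrite ![add _ a]addC => /injl.
- by have [y <-] := surjl a b; exists y; rewrite addC.
Qed.

Section Product.

Variables (Q : Type) (U : eqType) (dot add : Q -> Q -> Q) (star : U -> U -> U).
Variable j : U -> Q.
Hypotheses (U_quasigroup : quasigroup star) (U_idem : idempotent_op star).
Hypothesis add_abelian : abelian_group_op add.

Local Notation prod := (product_op dot add star j).

(** Once the right-hand [v] is expanded to [star v v], the common right factor cancels. *)
Lemma idem_star_eql (u v : U) : star u v = v -> u = v.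
Proof. by rewrite -[RHS]U_idem => /(quasigroup_mulIr _ _ _ _ _ U_quasigroup). Qed.

Lemma idem_star_eqr (u v : U) : star u v = u -> u = v.
Proof.
by rewrite -[RHS]U_idem => /(quasigroup_mulIl _ _ _ _ _ U_quasigroup).
Qed.

Lemma product_op_snd (p q : Q * U) : (prod p q).2 = star p.2 q.2.
Proof. by case: p q => [x u] [y v] /=; case: eqP => //= ->; rewrite U_idem. Qed.

Lemma product_op_diag (x y : Q) (u : U) : prod (x, u) (y, u) = (dot x y, u).
Proof. by rewrite /= eqxx. Qed.

Lemma product_op_offdiag (x y : Q) (u v : U) :
  u <> v -> prod (x, u) (y, v) = (add (add x y) (j u), star u v).
Proof. by move=> /eqP/negPf /= ->. Qed.

(** Second coordinates form an equation in [star] alone, which fixes the unknown's second coordinate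
    and hence the branch. The first coordinate is then solved in [dot] or in [add]. *)
Lemma product_op_quasigroup : quasigroup dot -> quasigroup prod.
Proof.
move=> Q_quasigroup.
have A_quasigroup := abelian_group_quasigroup _ _ add_abelian.
have dotIr a x y := quasigroup_mulIr Q dot a x y Q_quasigroup.
have dotIl a x y := quasigroup_mulIl Q dot a x y Q_quasigroup.
have addIr a x y := quasigroup_mulIr Q add a x y A_quasigroup.
have addIl a x y := quasigroup_mulIl Q add a x y A_quasigroup.
have starIr a x y := quasigroup_mulIr U star a x y U_quasigroup.
have starIl a x y := quasigroup_mulIl U star a x y U_quasigroup.
apply: quasigroupP => [[a u] [x v] [y w]|[a u] [x v] [y w]|[a u] [b w]|[a u] [b w]].
- move=> eq_p; have := congr1 snd eq_p.
  rewrite !product_op_snd => /starIr /= eq_vw; move: eq_p; rewrite -{}eq_vw.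
  have [->|/eqP ne_vu] := eqVneq v u; first by rewrite !product_op_diag => -[/dotIr ->].
  (* Both sides carry the same shift [j v], so it cancels first, then [a]. *)
  by rewrite !product_op_offdiag // => -[/addIr/addIr ->].
- move=> eq_p; have := congr1 snd eq_p.
  rewrite !product_op_snd => /starIl /= eq_vw; move: eq_p; rewrite -{}eq_vw.
  have [->|/eqP ne_uv] := eqVneq u v; first by rewrite !product_op_diag => -[/dotIl ->].
  by rewrite !product_op_offdiag // => -[/addIr/addIl ->].
- have [[v [<- _]] _] := U_quasigroup u w.
  have [->|/eqP ne_vu] := eqVneq v u.
    have [[x [<- _]] _] := Q_quasigroup a b.
    by exists (x, u); rewrite product_op_diag U_idem.
  (* As [v] is already known, [j v] is a constant: [c] is [b] minus [j v], and [x] is [c] minus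
     [a]. *)
  have [[c [<- _]] _] := A_quasigroup (j v) b.
  have [[x [<- _]] _] := A_quasigroup a c.
  by exists (x, v); rewrite product_op_offdiag.
- have [_ [v [<- _]]] := U_quasigroup u w.
  have [<-|/eqP ne_uv] := eqVneq u v.
    have [_ [y [<- _]]] := Q_quasigroup a b.
    by exists (y, u); rewrite product_op_diag U_idem.
  have [[c [<- _]] _] := A_quasigroup (j u) b.
  have [_ [y [<- _]]] := A_quasigroup a c.
  by exists (y, v); rewrite product_op_offdiag.
Qed.

Lemma product_op_assoc_snd (j_inj : injective j) (x y z : Q) (u v w : U) :
  prod (x, u) (prod (y, v) (z, w)) = prod (prod (x, u) (y, v)) (z, w) ->
  u = v /\ v = w.
Proof.
have starIr a s t := quasigroup_mulIr U star a s t U_quasigroup.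
have starIl a s t := quasigroup_mulIl U star a s t U_quasigroup.
move=> eq_p; have := congr1 snd eq_p; rewrite !product_op_snd /= => eq_uvw.
(* If [u = v], cancelling [u] in [star u (star u w) = star u w] gives [star u w = w], so [u = w];
   the case [v = w] is the mirror image. *)
have [eq_uv|/eqP ne_uv] := eqVneq u v.
  by move: eq_uvw; rewrite -eq_uv U_idem => /starIl/idem_star_eql.
have [eq_vw|/eqP ne_vw] := eqVneq v w.
  by move: eq_uvw; rewrite -eq_vw U_idem => /esym/starIr/idem_star_eqr.
(* Here the left side collapses to [u], that is [star v w]; cancelling [w] leaves [v = star u v]. *)
have [eq_u|/eqP ne_u] := eqVneq u (star v w).
  by move: eq_uvw; rewrite -eq_u U_idem {1}eq_u => /starIr/esym/idem_star_eql/ne_uv.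
have [eq_w|/eqP ne_w] := eqVneq (star u v) w.
  by move: eq_uvw; rewrite eq_w U_idem -{2}eq_w => /starIl/idem_star_eqr/ne_vw.
have addIl a s t :=
  quasigroup_mulIl Q add a s t (abelian_group_quasigroup _ _ add_abelian).
have [addA addC _] := add_abelian.
move: eq_p; rewrite !product_op_offdiag // => -[eq_add _].
(* All four products are now off the diagonal, and both first coordinates contain [x], [y], [z] and
   [j u]. What differs is [j v] against [j (star u v)]. *)
suff /j_inj/esym/idem_star_eql/ne_uv : j v = j (star u v) by [].
apply: (addIl (add (add (add x y) (j u)) z)); rewrite -eq_add.
by rewrite -!addA; do 2!congr (add _ _); rewrite [RHS]addA [RHS]addC.
Qed.

End Product.

Theorem theorem2p3 (Q U : finType)
  (dot : Q -> Q -> Q) (star : U -> U -> U)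
  (Q_mna : maximally_nonassociative dot)
  (U_quasigroup : quasigroup star)
  (U_idem : idempotent_op star)
  (card_UQ : #|U| <= #|Q|)
  (j : U -> Q) (j_inj : injective j)
  (add : Q -> Q -> Q) (add_abelian : abelian_group_op add) :
  maximally_nonassociative (product_op dot add star j).
Proof.
have [Q_quasigroup Q_nonassoc] := Q_mna.
split=> [|[x u] [y v] [z w] eq_p]; first exact: product_op_quasigroup.
have [eq_uv eq_vw] : u = v /\ v = w.
  exact: (product_op_assoc_snd _ _ _ _ _ _ U_quasigroup U_idem add_abelian j_inj
    x y z u v w eq_p).
(* All products now stay in the copy of [Q] over [w], where the operation is [dot]. *)
move: eq_p; rewrite eq_uv eq_vw !product_op_diag => -[/Q_nonassoc[-> ->]].
by [].
Qed.
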